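(* Let $\mathcal{T}$ denote the class of pairs $(A,B)$ of topologically weakly coupled systems, i.e. interconnected systems whose plant graph $\mathcal{G}_p$ is acyclic (has no directed cycles). Then, within the class $\mathcal{T}$, $$\Sigma_1=\Sigma_2=\{(A,B)\mid (A_{ii},B_i)\ \text{is stabilizable for every } i\in\mathcal{V}\},$$ that is, for every $(A,B)\in\mathcal{T}$ the following are equivalent: the system is decentralized stabilizable; the system is strongly decentralized stabilizable; each pair $(A_{ii},B_i)$, $i\in\mathcal{V}$, is stabilizable.
   Context: Setting. Let $\mathcal{G}_p(\mathcal{V},\mathcal{E}_p)$ be a directed graph (the plant graph) with nodes $\mathcal{V}=\{1,\ldots,N\}$ and edge set $\mathcal{E}_p\subseteq\mathcal{V}\times\mathcal{V}$ without self-loops; $(j,i)\in\mathcal{E}_p$ means that subsystem $j$ dynamically influences subsystem $i$. Put $\mathbb{N}_i=\{j\mid (j,i)\in\mathcal{E}_p\}$. Subsystem $i$ has state $x_i\in\mathbb{R}^{n_i}$, input $u_i\in\mathbb{R}^{m_i}$ and disturbance $d_i\in\mathbb{R}^{q_i}$, with dynamics $$\dot x_i(t)=A_{ii}x_i(t)+\sum_{j\in\mathbb{N}_i}A_{ij}x_j(t)+B_iu_i(t)+M_id_i(t),$$ where all matrices are real, $A_{ij}\in\mathbb{R}^{n_i\times n_j}$, $B_i\in\mathbb{R}^{n_i\times m_i}$. The overall system is $\dot x=Ax+Bu+Md$, where $x$ stacks the $x_i$ (similarly $u,d$), $A$ has blocks $A_{ij}$ with $A_{ij}=0$ whenever $i\ne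 j$ and $(j,i)\notin\mathcal{E}_p$, $B=\mathrm{diag}(B_1,\ldots,B_N)$ and $M=\mathrm{diag}(M_1,\ldots,M_N)$. A pair $(A_{ii},B_i)$ is stabilizable if there is a real matrix $K_{ii}\in\mathbb{R}^{m_i\times n_i}$ such that $A_{ii}-B_iK_{ii}$ is Hurwitz (all eigenvalues have negative real part). Decentralized stabilizable: there exists a decentralized static feedback $u_i=-K_{ii}x_i$, $K_{ii}\in\mathbb{R}^{m_i\times n_i}$, $i\in\mathcal{V}$, i.e. $K=\mathrm{diag}(K_{11},\ldots,K_{NN})$, such that the closed-loop system $\dot x=(A-BK)x$ is asymptotically stable. $\Sigma_1$ is the set of pairs $(A,B)$ for which the system is decentralized stabilizable. Strongly decentralized stabilizable: there exists such a decentralized feedback for which the closed-loop system $\dot x=(A-BK)x$ admits a block-diagonal Lyapunov function $V(x)=\sum_{i=1}^N x_i^{\mathsf T}P_ix_i$. That is, there are symmetric positive definite $P_i\in\mathbb{R}^{n_i\times n_i}$ such that, with $P=\mathrm{diag}(P_1,\ldots,P_N)$, $(A-BK)^{\mathsf T}P+P(A-BK)\prec 0$ (symmetric negative definite). $\Sigma_2$ is the set of pairs $(A,B)$ for which the system is strongly decentralized stabilizable. *)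

(* Defs.v *)
From HB Require Import structures.
From mathcomp Require Import all_boot all_order all_algebra complex.
From mathcomp Require Import all_classical all_reals all_analysis.
Set Implicit Arguments.
Unset Strict Implicit.
Unset Printing Implicit Defensive.
Import Order.TTheory GRing.Theory Num.Theory numFieldNormedType.Exports.
Local Open Scope classical_set_scope.
Local Open Scope ring_scope.

(* A directed cycle is a nonempty closed walk without repeated vertices; loops
   count as cycles of length one. *)
Definition acyclic_graph (V : finType) (E : rel V) : Prop :=
  forall c : seq V, ucycle E c -> c = [::].

(* [\mxdiag_i] only covers square blocks.  Under the test [i == j] the two
   dimensions agree, so [conform_mx] is then the identity. *)
Definition blockdiag (R : nmodType) (N : nat) (p q : 'I_N -> nat)
    (D : forall i, 'M[R]_(p i, q i)) : 'M[R]_(\sum_i p i, \sum_i q i) :=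
  \mxblock_(i, j) (if i == j then conform_mx 0 (D i) else 0).

Definition hurwitz (R : realType) (k : nat) (F : 'M[R]_k) : Prop :=
  forall lam : R[i],
    eigenvalue (map_mx (real_complex R) F) lam -> complex.Re lam < 0.

Definition stabilizable (R : realType) (k l : nat)
    (F : 'M[R]_k) (G : 'M[R]_(k, l)) : Prop :=
  exists K : 'M[R]_(l, k), hurwitz (F - G *m K).

(* The values at negative times are irrelevant: any solution on [0, +oo[ with a
   one-sided derivative at 0 extends to such a function. *)
Definition solution (R : realType) (k : nat) (F : 'M[R]_k)
    (x : R -> 'cV[R]_k) : Prop :=
  forall t : R, 0 <= t -> is_derive t 1 x (F *m x t).

(* Lyapunov stability of the origin, together with attractivity (global, which
   for a linear system is the same as local). *)
Definition asymptotically_stable (R : realType) (k : nat) (F : 'M[R]_k) : Prop :=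
  (forall eps : R, 0 < eps -> exists2 delta : R, 0 < delta &
     forall x : R -> 'cV[R]_k, solution F x -> `|x 0| < delta ->
       forall t : R, 0 <= t -> `|x t| < eps) /\
  (forall x : R -> 'cV[R]_k, solution F x -> x t @[t --> +oo] --> (0 : 'cV[R]_k)).

Definition posdef (R : realType) (k : nat) (P : 'M[R]_k) : Prop :=
  P^T = P /\ forall v : 'cV[R]_k, v != 0 -> 0 < (v^T *m P *m v) 0 0.

Definition negdef (R : realType) (k : nat) (P : 'M[R]_k) : Prop :=
  posdef (- P).

Section Interconnection.
Variables (R : realType) (N : nat) (n m : 'I_N -> nat).
Variables (A : forall i j, 'M[R]_(n i, n j)) (B : forall i, 'M[R]_(n i, m i)).

(* A - B K for the feedback u_i = - K_ii x_i. *)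
Definition closed_loop (K : forall i, 'M[R]_(m i, n i)) :
    'M[R]_(\sum_i n i) :=
  \mxblock_(i, j) A i j - blockdiag B *m blockdiag K.

Definition decentralized_stabilizable : Prop :=
  exists K : forall i, 'M[R]_(m i, n i), asymptotically_stable (closed_loop K).

Definition strongly_decentralized_stabilizable : Prop :=
  exists (K : forall i, 'M[R]_(m i, n i)) (P : forall i, 'M[R]_(n i)),
    (forall i, posdef (P i)) /\
    negdef ((closed_loop K)^T *m \mxdiag_i P i + \mxdiag_i P i *m closed_loop K).

End Interconnection.

(* Main.v *)
Require Import Defs.
From HB Require Import structures.
From mathcomp Require Import all_boot all_order all_algebra complex.
From mathcomp Require Import all_classical all_reals all_analysis.
From mathcomp Require Import ring lra.
Set Implicit Arguments.
Unset Strict Implicit.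
Unset Printing Implicit Defensive.
Import Order.TTheory GRing.Theory Num.Theory numFieldNormedType.Exports.
Local Open Scope ring_scope.

(** The theorem follows from a cycle of three implications: strong
decentralized stabilizability gives decentralized stabilizability, which gives
stabilizability of every pair [(A i i, B i)], which in turn gives strong
decentralized stabilizability.  Acyclicity provides a height on the nodes that
increases along every edge, so that every closed loop [F = A - B K] is block
triangular for the strict order of heights ([acyclic_height],
[closed_loop_triangular]).

Strong to decentralized: a quadratic Lyapunov function decays exponentially
along solutions and dominates the squared norm ([lyapunov_decay],
[lyapunov_stable]).

Decentralized to local, with the same gains: in an asymptotically stable
system every eigenvalue has negative real part, since an eigenvector of an
eigenvalue with nonnegative real part gives two real solutions that do not both
vanish at infinity ([stable_hurwitz]); and an eigenvalue of a diagonal block of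
a block triangular matrix is an eigenvalue of the matrix
([block_eigenvalue]).

Local to strong, again with the same gains: each Hurwitz diagonal block
[F i i] has a Lyapunov matrix [Q i] ([hurwitz_lyapunov]), and for suitable
weights [c i] the matrices [c i *: Q i] form a Lyapunov matrix of the whole loop
([block_lyapunov]).  Both of these last facts are instances of one observation
([dissipative_weights]): in a cascade whose members dissipate their own energy,
weights that drop fast enough along the cascade make the weighted total energy
dissipate, as the coupling terms become negligible.  For [hurwitz_lyapunov] the
cascade is the Schur triangular form over the complex numbers, with scalar
members; for [block_lyapunov] it is the plant graph. *)

(** * Quadratic forms and Lyapunov matrices *)

Definition bilin (R : realType) k (P : 'M[R]_k) (u v : 'cV[R]_k) : R :=
  (u^T *m P *m v) 0 0.

Lemma bilinE (R : realType) k (P : 'M[R]_k) u v :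
  bilin P u v = \sum_i \sum_j u i 0 * P i j * v j 0.
Proof.
rewrite /bilin -mulmxA mxE; apply: eq_bigr => i _.
by rewrite !mxE mulr_sumr; apply: eq_bigr => j _; rewrite mulrA.
Qed.

Lemma bilinC (R : realType) k (P : 'M[R]_k) u v :
  P^T = P -> bilin P u v = bilin P v u.
Proof.
move=> PT; have E : v^T *m P *m u = (u^T *m P *m v)^T.
  by rewrite !trmx_mul trmxK PT mulmxA.
by rewrite /bilin E [RHS]mxE.
Qed.

Lemma bilinDr (R : realType) k (P : 'M[R]_k) u v w :
  bilin P u (v + w) = bilin P u v + bilin P u w.
Proof. by rewrite /bilin mulmxDr mxE. Qed.

Lemma bilinZr (R : realType) k (P : 'M[R]_k) u a v :
  bilin P u (a *: v) = a * bilin P u v.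
Proof. by rewrite /bilin -scalemxAr mxE. Qed.

Lemma bilinZl (R : realType) k (P : 'M[R]_k) u a v :
  bilin P (a *: u) v = a * bilin P u v.
Proof. by rewrite /bilin linearZ /= -!scalemxAl mxE. Qed.

Lemma bilinDl (R : realType) k (P : 'M[R]_k) u v w :
  bilin P (u + v) w = bilin P u w + bilin P v w.
Proof. by rewrite /bilin linearD /= !mulmxDl mxE. Qed.

Lemma posdef_ge0 (R : realType) k (P : 'M[R]_k) v :
  posdef P -> 0 <= bilin P v v.
Proof.
move=> [_ Ppos]; have [->|/Ppos/ltW//] := eqVneq v 0.
by rewrite /bilin mulmx0 mxE.
Qed.

(** Positivity of the form at [s *: u - v].  The coupling terms are estimated by
this form of Young's inequality rather than by Cauchy-Schwarz, which would bring
in square roots of energies. *)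
Lemma bilin_young (R : realType) k (P : 'M[R]_k) (s : R) u v :
  posdef P -> 0 < s ->
  2 * bilin P u v <= s * bilin P u u + bilin P v v / s.
Proof.
move=> Ppos s_gt0; have := posdef_ge0 (s *: u + (-1) *: v) Ppos.
rewrite !(bilinDl, bilinDr, bilinZl, bilinZr) (bilinC v u Ppos.1) => H.
rewrite -subr_ge0 -(pmulr_rge0 _ s_gt0).
move: H; congr (_ <= _).
by field; rewrite gt_eqF.
Qed.

Lemma bilin_cauchy_schwarz (R : realType) k (P : 'M[R]_k) u v : posdef P ->
  bilin P u v ^+ 2 <= bilin P u u * bilin P v v.
Proof.
move=> Ppos; have [->|u_neq0] := eqVneq u 0.
  by rewrite /bilin trmx0 !mul0mx !mxE expr0n mul0r.
have u_gt0 : 0 < bilin P u u by apply: Ppos.2.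
have := posdef_ge0 (v - (bilin P u v / bilin P u u) *: u) Ppos.
rewrite -scaleNr !(bilinDl, bilinDr, bilinZl, bilinZr) (bilinC v u Ppos.1) => H.
rewrite -subr_ge0; have := mulr_ge0 (ltW u_gt0) H; congr (_ <= _).
by field; rewrite gt_eqF.
Qed.

Lemma posdef_unit (R : realType) k (P : 'M[R]_k) : posdef P -> P \in unitmx.
Proof.
move=> Ppos; rewrite -row_free_unit -kermx_eq0.
apply/rowV0P => u /sub_kermxP uP0; apply/eqP/negPn/negP => u_neq0.
have /Ppos.2 : u^T != 0.
  by apply: contraNneq u_neq0 => /(canRL (@trmxK _ _ _)) ->; rewrite trmx0.
by rewrite trmxK uP0 mul0mx mxE ltxx.
Qed.

(** The [i]-th coordinate of [v] is [bilin P v w] for [w] the [i]-th column of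
the inverse of [P], so Cauchy-Schwarz bounds its square by the form at [v].
This replaces the usual compactness argument on the unit sphere. *)
Lemma posdef_coord (R : realType) k (P : 'M[R]_k) : posdef P ->
  exists2 g : R, 0 < g & forall (v : 'cV_k) i, v i 0 ^+ 2 <= g * bilin P v v.
Proof.
move=> Ppos; pose w i : 'cV[R]_k := invmx P *m delta_mx i 0.
exists (1 + \sum_i bilin P (w i) (w i)).
  by apply: ltr_wpDr => //; apply: sumr_ge0 => i _; exact: posdef_ge0.
move=> v i.
have <- : bilin P v (w i) = v i 0.
  by rewrite /bilin -mulmxA mulKVmx ?posdef_unit // -colE !mxE.
apply: le_trans (bilin_cauchy_schwarz _ _ Ppos) _.
rewrite mulrC ler_wpM2r ?posdef_ge0 // (bigD1 i) //= addrCA lerDl.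
by rewrite addr_ge0 // sumr_ge0 // => j _; exact: posdef_ge0.
Qed.

(** A consequence of [posdef_coord].  It turns the strict negativity of a Lyapunov
inequality into a uniform decay rate ([lyapunov_rate]), and it bounds the
coupling between blocks ([block_lyapunov]). *)
Lemma posdef_dominates (R : realType) k (P S : 'M[R]_k) : posdef P ->
  exists2 b : R, 0 < b & forall v, bilin S v v <= b * bilin P v v.
Proof.
move=> Ppos; have [g g_gt0 gP] := posdef_coord Ppos.
exists (1 + \sum_i \sum_j `|S i j| * g).
  apply: ltr_wpDr => //; do 2![apply: sumr_ge0 => ? _].
  by rewrite mulr_ge0 // ltW.
move=> v; rewrite mulrDl mul1r bilinE; apply: ler_wpDl; first exact: posdef_ge0.
rewrite mulr_suml; apply: ler_sum => i _; rewrite mulr_suml.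
apply: ler_sum => j _; apply: le_trans (ler_norm _) _.
rewrite mulrAC normrM mulrC -mulrA ler_wpM2l //.
rewrite ler_norml; have := gP v i; have := gP v j; nra.
Qed.

Lemma lyapunov_bilin (R : realType) k (P F : 'M[R]_k) v : P^T = P ->
  bilin (F^T *m P + P *m F) v v = 2 * bilin P v (F *m v).
Proof.
move=> PT; have -> : bilin (F^T *m P + P *m F) v v =
    bilin P (F *m v) v + bilin P v (F *m v).
  by rewrite /bilin mulmxDr mulmxDl mxE trmx_mul !mulmxA.
by rewrite (bilinC (F *m v) v PT) mulr2n mulrDl mul1r.
Qed.

Lemma negdef_lyapunov (R : realType) k (P F : 'M[R]_k) : P^T = P ->
  negdef (F^T *m P + P *m F) <->
  (forall v, v != 0 -> bilin P v (F *m v) < 0).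
Proof.
move=> PT; have E v : (v^T *m - (F^T *m P + P *m F) *m v) 0 0 =
    - (2 * bilin P v (F *m v)).
  by rewrite -lyapunov_bilin // /bilin mulmxN mulNmx mxE.
split=> [[_ H] v /H|H]; first by rewrite E; lra.
split=> [|v /H]; last by rewrite E; lra.
by rewrite linearN /= linearD /= !trmx_mul trmxK PT addrC.
Qed.

Lemma lyapunov_rate (R : realType) k (P F : 'M[R]_k) : posdef P ->
  negdef (F^T *m P + P *m F) ->
  exists2 a : R, 0 < a & forall v, bilin P v (F *m v) <= - a * bilin P v v.
Proof.
move=> Ppos Fneg; have [b b_gt0 bP] := posdef_dominates P Fneg.
exists (2 * b)^-1; first by rewrite invr_gt0 mulr_gt0.
move=> v; have := bP v.
have -> : bilin (- (F^T *m P + P *m F)) v v = - (2 * bilin P v (F *m v)).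
  by rewrite -lyapunov_bilin ?Ppos.1 // /bilin mulmxN mulNmx mxE.
move=> H; rewrite mulNr lerNr mulrC ler_pdivrMr ?mulr_gt0 //.
by apply: le_trans H _; lra.
Qed.

(** * Energy in a cascade *)

(** With [q i] the energy of member [i] and [X i j] the power that [j] feeds
into [i], self-dissipation at rate [a] outweighs all couplings once the energies
are weighted by [e ^+ (2 * h i)] with [e] small.  Indeed for [h j < h i] the
coupling bound at [s := e] reads [X i j <= e * q i + b * q j / e], and the factor
[e^-1] is absorbed because the weight of [i] is at most [e ^+ 2] times that of
[j]: both terms become weighted energies with a factor [e].  The weights depend
on [a], [b] and [h] only, so that they are available before the state, which
determines [q] and [X], is known. *)
Lemma dissipative_weights (R : realType) N (h : 'I_N -> nat) (a b : R) :
  0 < a -> 0 < b ->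
  exists2 c : 'I_N -> R, forall i, 0 < c i &
  forall (q : 'I_N -> R) (X : 'I_N -> 'I_N -> R),
    (forall i, 0 <= q i) ->
    (forall i, X i i <= - a * q i) ->
    (forall i j : 'I_N, i != j -> ~~ (h j < h i)%N -> X i j <= 0) ->
    (forall i j (s : R), 0 < s -> X i j <= s * q i + b * q j / s) ->
  \sum_i c i * \sum_j X i j <= - (a / 2) * \sum_i c i * q i.
Proof.
move=> a_gt0 b_gt0.
(* Small enough for the coupling sum, at most [e * N * (1 + b)] times the
   total energy, to consume no more than half of the rate [a]. *)
pose e := a / (a + 2 * N%:R * (1 + b)).
have den_gt0 : 0 < a + 2 * N%:R * (1 + b).
  by rewrite ltr_wpDr // !mulr_ge0 // addr_ge0 // ltW.
have e_gt0 : 0 < e by rewrite divr_gt0.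
have e_le1 : e <= 1.
  by rewrite ler_pdivrMr // mul1r lerDl !mulr_ge0 // addr_ge0 // ltW.
have eN : e * N%:R * (1 + b) <= a / 2.
  rewrite /e (_ : _ * _ * _ =
      a / 2 * ((2 * N%:R * (1 + b)) / (a + 2 * N%:R * (1 + b)))).
    rewrite ler_piMr ?divr_ge0 ?ltW // ltr_pdivrMr // mul1r.
    by rewrite ltrDr.
  by field; rewrite gt_eqF.
pose c i := e ^+ (2 * h i).
have c_gt0 i : 0 < c i by rewrite exprn_gt0.
exists c => // q X q_ge0 Xdiag Xnil Xtri.
have cq_ge0 i : 0 <= c i * q i by rewrite mulr_ge0 // ltW.
have eb_gt0 : 0 < e * b by rewrite mulr_gt0.
have cX i j : c i * X i j <= (if j == i then - a * (c i * q i) else 0)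
    + e * (c i * q i) + e * b * (c j * q j).
  have p1 := mulr_ge0 (ltW e_gt0) (cq_ge0 i).
  have p2 := mulr_ge0 (ltW eb_gt0) (cq_ge0 j).
  case: eqVneq => [jE|ji].
    have : c i * X i i <= - a * (c i * q i).
      by rewrite mulrCA; apply: ler_wpM2l => //; exact: ltW.
    by rewrite jE in p2 *; lra.
  case: (boolP (h j < h i)%N) => hji; last first.
    have : c i * X i j <= 0.
      by apply: mulr_ge0_le0; [exact: ltW | apply: Xnil; rewrite // eq_sym].
    lra.
  have := ler_wpM2l (ltW (c_gt0 i)) (Xtri i j e e_gt0).
  have : c i * (b * q j / e) <= e * b * (c j * q j).
    rewrite (_ : c i * _ = (c i / e) * (b * q j)); last by ring.
    rewrite (_ : e * b * _ = (e * c j) * (b * q j)); last by ring.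
    apply: ler_wpM2r; first by rewrite mulr_ge0 // ltW.
    rewrite ler_pdivrMr // /c -exprS -exprSr ler_wiXn2l ?(ltW e_gt0) //.
    by rewrite !mul2n -doubleS leq_double.
  lra.
have step i : c i * \sum_j X i j <= - a * (c i * q i)
    + N%:R * (e * (c i * q i)) + e * b * \sum_j c j * q j.
  rewrite [leLHS]mulr_sumr; apply: le_trans.
    by apply: ler_sum => j _; exact: cX.
  rewrite !big_split /= -big_mkcond big_pred1_eq sumr_const card_ord.
  by rewrite -mulr_sumr -[_ *+ N]mulr_natl.
apply: le_trans; first by apply: ler_sum => i _; exact: step.
rewrite !big_split /= -!mulr_sumr sumr_const card_ord -[_ *+ N]mulr_natl.
set S := \sum_i _; have S_ge0 : 0 <= S by apply: sumr_ge0.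
have := ler_wpM2r S_ge0 eN; lra.
Qed.

(** * The converse Lyapunov theorem *)

Lemma pos_lower_bound (R : realType) (I : finType) (f : I -> R) :
  (forall i, 0 < f i) ->
  exists2 a : R, 0 < a & forall i, a <= f i.
Proof.
move=> f_gt0; have S_ge0 : 0 <= \sum_i (f i)^-1.
  by apply: sumr_ge0 => i _; rewrite invr_ge0 ltW.
exists (1 + \sum_i (f i)^-1)^-1 => [|i]; first by rewrite invr_gt0 ltr_wpDr.
rewrite -[leRHS]invrK lef_pV2 ?posrE ?invr_gt0 ?ltr_wpDr //.
rewrite (bigD1 i) //= addrCA lerDl addr_ge0 // sumr_ge0 // => j _.
by rewrite invr_ge0 ltW.
Qed.

Lemma Re_sum (R : realType) (I : finType) (g : I -> R[i]) :
  complex.Re (\sum_i g i) = \sum_i complex.Re (g i).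
Proof. by apply: big_morph => // -[? ?] []. Qed.

Lemma Im_sum (R : realType) (I : finType) (g : I -> R[i]) :
  complex.Im (\sum_i g i) = \sum_i complex.Im (g i).
Proof. by apply: big_morph => // -[? ?] []. Qed.

Lemma Re_mulmx_real (R : realType) k l (U : 'M[R[i]]_(l, k)) (v : 'cV[R]_k) i :
  complex.Re ((U *m map_mx (real_complex R) v) i 0) =
  (map_mx (@complex.Re R) U *m v) i 0.
Proof.
rewrite !mxE Re_sum; apply: eq_bigr => j _; rewrite !mxE.
by case: (U i j) => x y /=; rewrite mulr0 subr0.
Qed.

Lemma Im_mulmx_real (R : realType) k l (U : 'M[R[i]]_(l, k)) (v : 'cV[R]_k) i :
  complex.Im ((U *m map_mx (real_complex R) v) i 0) =
  (map_mx (@complex.Im R) U *m v) i 0.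
Proof.
rewrite !mxE Im_sum; apply: eq_bigr => j _; rewrite !mxE.
by case: (U i j) => x y /=; rewrite mulr0 add0r.
Qed.

Lemma eigenvalue_unitmx (K : fieldType) k (g : 'M[K]_k) a :
  eigenvalue g a = (g - a%:M \notin unitmx).
Proof. by rewrite /eigenvalue /eigenspace kermx_eq0 row_free_unit. Qed.

(** Let [U] be a unitary matrix that brings [F] to a lower triangular form [T].
In the coordinates [w v := U *m v] the system is a cascade of scalar members
whose rates of self-dissipation are the opposites of the real parts of the
eigenvalues.  A weighted sum of squared moduli of these coordinates is therefore
a Lyapunov function; on real vectors it is a real quadratic form, with matrix
[X^T *m C *m X + Y^T *m C *m Y] for [U] with real part [X] and imaginary part
[Y]. *)
Lemma hurwitz_lyapunov (R : realType) k (F : 'M[R]_k) : hurwitz F ->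
  exists2 P : 'M[R]_k, posdef P & negdef (F^T *m P + P *m F).
Proof.
case: k F => [|k] F Fhur.
  have nz (v : 'cV[R]_0) : v != 0 -> False by rewrite [v]flatmx0 eqxx.
  by exists 0; split=> [|v /nz//]; apply/matrixP => -[].
pose Fc := map_mx (real_complex R) F.
have [U /unitarymx_unit Uunit Ttrig] := Schur Fc (ltn0Sn k).
pose T := conjmx U Fc; have {Ttrig} /is_trig_mxP Ttrig : is_trig_mx T := Ttrig.
have UF : U *m Fc = T *m U by rewrite /T conjumx // mulmxKV.
clearbody T.
have Tdiag i : complex.Re (T i i) < 0.
  apply: Fhur; rewrite eigenvalue_unitmx -/Fc.
  have <- : (U *m (Fc - (T i i)%:M) \notin unitmx) =
      (Fc - (T i i)%:M \notin unitmx).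
    by rewrite unitmx_mul Uunit.
  rewrite mulmxBr UF scalar_mxC -mulmxBl unitmx_mul Uunit andbT.
  rewrite unitmxE unitfE negbK det_trig.
    by rewrite (bigD1 i) //= !mxE eqxx mulr1n subrr mul0r.
  apply/is_trig_mxP => l j lj; rewrite !mxE Ttrig //.
  by rewrite -val_eqE /= (ltn_eqF lj) subr0.
have [a a_gt0 aT] := pos_lower_bound (fun i => etrans (oppr_gt0 _) (Tdiag i)).
pose nsq (z : R[i]) := complex.Re z ^+ 2 + complex.Im z ^+ 2.
have nsq_ge0 z : 0 <= nsq z by rewrite addr_ge0 // sqr_ge0.
pose b := 1 + \sum_i \sum_j nsq (T i j).
have b_gt0 : 0 < b.
  by rewrite ltr_wpDr // sumr_ge0 // => i _; apply: sumr_ge0.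
have Tb i j : nsq (T i j) <= b.
  rewrite /b (bigD1 i) //= (bigD1 j) //= addrCA -addrA lerDl !addr_ge0 //.
    by apply: sumr_ge0.
  by apply: sumr_ge0 => l _; apply: sumr_ge0.
have [c c_gt0 cP] := dissipative_weights (@nat_of_ord k.+1) a_gt0 b_gt0.
pose X := map_mx (@complex.Re R) U; pose Y := map_mx (@complex.Im R) U.
pose C : 'M[R]_k.+1 := diag_mx (\row_i c i).
pose P : 'M[R]_k.+1 := X^T *m C *m X + Y^T *m C *m Y.
have PT : P^T = P.
  by rewrite /P linearD /= !trmx_mul !trmxK tr_diag_mx !mulmxA.
pose w (v : 'cV[R]_k.+1) := U *m map_mx (real_complex R) v.
have PE u v : bilin P u v = \sum_i c i *
    (complex.Re (w u i 0) * complex.Re (w v i 0)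
     + complex.Im (w u i 0) * complex.Im (w v i 0)).
  have CE (x y : 'cV[R]_k.+1) :
      (x^T *m C *m y) 0 0 = \sum_i c i * (x i 0 * y i 0).
    rewrite -mulmxA mul_diag_mx mxE; apply: eq_bigr => i _.
    by rewrite !mxE mulrCA.
  rewrite /bilin /P mulmxDr mulmxDl mxE.
  have -> : u^T *m (X^T *m C *m X) *m v = (X *m u)^T *m C *m (X *m v).
    by rewrite trmx_mul !mulmxA.
  have -> : u^T *m (Y^T *m C *m Y) *m v = (Y *m u)^T *m C *m (Y *m v).
    by rewrite trmx_mul !mulmxA.
  rewrite !CE -big_split /=; apply: eq_bigr => i _.
  by rewrite !Re_mulmx_real !Im_mulmx_real mulrDr.
have Pgt0 v : v != 0 -> 0 < \sum_i c i * nsq (w v i 0).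
  move=> v_neq0; have : w v != 0.
    apply: contra_neq v_neq0 => wv0; apply/(@map_mx_inj _ _ (real_complex R)).
    by rewrite -[LHS](mulKmx Uunit) -/(w v) wv0 mulmx0 map_mx0.
  case/cV0Pn => i wi; apply: lt_le_trans (_ : c i * nsq (w v i 0) <= _).
    rewrite mulr_gt0 // lt_neqAle nsq_ge0 andbT eq_sym.
    by apply: contra wi; rewrite eq_complex paddr_eq0 ?sqr_ge0 // !sqrf_eq0.
  rewrite (bigD1 i) //= lerDl; apply: sumr_ge0 => j _.
  by rewrite mulr_ge0 // ltW.
have Ppos : posdef P.
  split=> // v /Pgt0; congr (_ < _); rewrite -/(bilin P v v) PE.
  by apply: eq_bigr.
exists P => //; apply/negdef_lyapunov => // v /Pgt0 v_gt0.
(* The power fed from coordinate [j] into coordinate [i], namely the real part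
   of [conj (w i) * T i j * w j]. *)
pose D i j := complex.Re (w v i 0) * complex.Re (T i j * w v j 0)
     + complex.Im (w v i 0) * complex.Im (T i j * w v j 0).
have wF i : w (F *m v) i 0 = \sum_j T i j * w v j 0.
  by rewrite /w map_mxM mulmxA UF -mulmxA mxE.
have -> : bilin P v (F *m v) = \sum_i c i * \sum_j D i j.
  rewrite PE; apply: eq_bigr => i _; congr (_ * _).
  by rewrite wF Re_sum Im_sum !mulr_sumr -big_split.
apply: le_lt_trans (cP (fun i => nsq (w v i 0)) D _ _ _ _) _ => //.
- move=> i; rewrite /D /nsq; have := aT i; case: (T i i) => t1 t2 /=.
  case: (w v i 0) => x y /=; nra.
- move=> i j ij ji; rewrite /D Ttrig ?mul0r ?mulr0 ?addr0 //.
  by rewrite ltn_neqAle ij leqNgt.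
- move=> i j s s_gt0 /=.
  have : nsq (T i j * w v j 0) <= b * nsq (w v j 0).
    apply: le_trans (ler_wpM2r (nsq_ge0 _) (Tb i j)).
    rewrite /nsq; case: (T i j) (w v j 0) => ? ? [? ?] /=; lra.
  rewrite /D; move: (b * _) => B; case: (T i j * _) (w v i 0) => m1 m2 [r1 r2].
  rewrite /nsq /= => mB; rewrite -(ler_pM2l s_gt0) [leRHS]mulrDr.
  rewrite (mulrC s (B / s)) divfK ?gt_eqF //.
  apply: le_trans (_ : s * (s * (r1 ^+ 2 + r2 ^+ 2)) + (m1 ^+ 2 + m2 ^+ 2) <= _).
    have := sqr_ge0 (s * r1 - m1); have := sqr_ge0 (s * r2 - m2).
    have := sqr_ge0 (s * r1 + m1); have := sqr_ge0 (s * r2 + m2).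
    have := sqr_ge0 m1; have := sqr_ge0 m2.
    have := sqr_ge0 (s * r1); have := sqr_ge0 (s * r2).
    lra.
  by rewrite lerD2l.
by rewrite mulNr oppr_lt0 mulr_gt0 // divr_gt0.
Qed.

(** * Asymptotic stability of linear systems *)

Lemma is_derive_mxP (R : realType) k l (M : R -> 'M[R]_(k, l)) (t : R)
    (dM : 'M[R]_(k, l)) :
  is_derive t 1 M dM <-> forall i j, is_derive t 1 (fun s => M s i j) (dM i j).
Proof.
split=> [MdM i j|MdM].
  have dMt : derivable M t 1 by apply: ex_derive.
  apply: DeriveDef; first exact: (derivable_mxP M t 1).1.
  by rewrite -(derive_val (is_derive := MdM)) derive_mx // mxE.
have dMt : derivable M t 1 by apply/derivable_mxP => i j; apply: ex_derive.
apply: DeriveDef => //; rewrite derive_mx //.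
by apply/matrixP => i j; rewrite mxE (derive_val (is_derive := MdM i j)).
Qed.

Lemma is_derive_bilin (R : realType) k (P : 'M[R]_k) (u v : R -> 'cV[R]_k)
    (t : R) du dv :
  is_derive t 1 u du -> is_derive t 1 v dv ->
  is_derive t 1 (fun s => bilin P (u s) (v s))
    (bilin P du (v t) + bilin P (u t) dv).
Proof.
move=> /is_derive_mxP udu /is_derive_mxP vdv.
have -> : (fun s => bilin P (u s) (v s)) =
    \sum_i \sum_j (P i j \*: ((fun s => u s i 0) * (fun s => v s j 0))).
  apply/funext => s; rewrite bilinE fct_sumE; apply: eq_bigr => i _.
  by rewrite fct_sumE; apply: eq_bigr => j _; rewrite mulrAC mulrC.
apply: is_derive_eq.
rewrite !bilinE -big_split; apply: eq_bigr => i _.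
rewrite -big_split; apply: eq_bigr => j _ /=.
rewrite /GRing.scale /=; ring.
Qed.

Lemma mx_norm_le (R : realType) k (v : 'cV[R]_k) (r : R) : 0 <= r ->
  (forall i, v i 0 ^+ 2 <= r ^+ 2) -> `|v| <= r.
Proof.
move=> r_ge0 vr; rewrite [leLHS]/Num.Def.normr/= mx_normrE.
apply: bigmax_le => // -[i j] _ /=; rewrite ord1.
by rewrite -ler_sqr ?nnegrE // real_normK ?num_real.
Qed.

Lemma coord_le_mx_norm (R : realType) k (v : 'cV[R]_k) i : `|v i 0| <= `|v|.
Proof.
rewrite [leRHS]/Num.Def.normr/= mx_normrE.
exact: (le_bigmax _ (fun ij => `|v ij.1 ij.2|) (i, 0)).
Qed.

(** With [V t := bilin P (x t) (x t)] the Lyapunov inequality says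
[V' <= - 2 * a * V], so [expR (2 * a * t) * V t] is nonincreasing; the norm of
[x t] is compared with [V t] at both ends. *)
Lemma lyapunov_decay (R : realType) k (F P : 'M[R]_k) : posdef P ->
  negdef (F^T *m P + P *m F) ->
  exists2 a : R, 0 < a & exists2 c : R, 0 < c &
  forall x, solution F x -> forall t : R, 0 <= t ->
    `|x t| <= c * expR (- (a * t)) * `|x 0|.
Proof.
move=> Ppos Fneg; have [a a_gt0 aP] := lyapunov_rate Ppos Fneg.
have [g g_gt0 gP] := posdef_coord Ppos.
pose p : R := \sum_i \sum_j `|P i j|.
have p_ge0 : 0 <= p by apply: sumr_ge0 => i _; apply: sumr_ge0.
have pP v : bilin P v v <= p * `|v| ^+ 2.
  rewrite bilinE mulr_suml; apply: ler_sum => i _; rewrite mulr_suml.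
  apply: ler_sum => j _; apply: le_trans (ler_norm _) _.
  rewrite mulrAC normrM mulrC ler_wpM2l // normrM expr2.
  by rewrite ler_pM // coord_le_mx_norm.
exists a => //; exists (1 + g * p).
  by rewrite ltr_wpDr // mulr_ge0 // ltW.
move=> x xF t t_ge0.
pose W s := expR (2 * a * s) * bilin P (x s) (x s).
pose dW s := expR (2 * a * s) *
   (2 * a * bilin P (x s) (x s) + 2 * bilin P (x s) (F *m x s)).
have WdW (s : R) : 0 <= s -> is_derive s 1 W (dW s).
  move=> s_ge0; have xs := xF s s_ge0.
  have := is_derive_bilin P xs xs => xsP.
  rewrite /W; apply: is_derive_eq; rewrite /dW (bilinC (F *m x s) (x s) Ppos.1).
  rewrite /GRing.scale /=; ring.
have Wt : W t <= W 0.
  apply: (@ler0_derive1_nincry _ W 0) => //.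
  - move=> s; rewrite in_itv /= andbT => /ltW s_ge0.
    by have := WdW s s_ge0 => ?; apply: ex_derive.
  - move=> s; rewrite in_itv /= andbT => /ltW s_ge0; rewrite derive1E.
    rewrite (derive_val (is_derive := WdW s s_ge0)) /dW.
    rewrite mulr_ge0_le0 ?expR_ge0 //; have := aP (x s); lra.
  - apply: derivable_within_continuous => s; rewrite in_itv /= andbT => s_ge0.
    by have := WdW s s_ge0 => ?; apply: ex_derive.
have c_ge1 : 1 <= 1 + g * p by rewrite lerDl mulr_ge0 // ltW.
have ex_gt0 : 0 < expR (- (a * t)) by exact: expR_gt0.
apply: mx_norm_le => [|i].
  by rewrite !mulr_ge0 ?(ltW ex_gt0) ?(le_trans ler01 c_ge1).
apply: le_trans (gP _ _) _.
have Vt : bilin P (x t) (x t) <= expR (- (a * t)) ^+ 2 * (p * `|x 0| ^+ 2).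
  have -> : bilin P (x t) (x t) = expR (- (a * t)) ^+ 2 * W t.
    rewrite /W mulrA -expRM_natl -expRD (_ : _ + _ = 0) ?expR0 ?mul1r //; ring.
  rewrite ler_wpM2l ?sqr_ge0 //; apply: le_trans Wt _.
  by rewrite /W mulr0 expR0 mul1r.
rewrite !exprMn.
apply: le_trans (_ : g * p * (expR (- (a * t)) ^+ 2 * `|x 0| ^+ 2) <= _).
  rewrite -mulrA ler_pM2l //; apply: le_trans Vt _; lra.
rewrite -[leRHS]mulrA ler_wpM2r ?mulr_ge0 ?sqr_ge0 //; nra.
Qed.

Lemma lyapunov_stable (R : realType) k (F P : 'M[R]_k) : posdef P ->
  negdef (F^T *m P + P *m F) -> asymptotically_stable F.
Proof.
move=> Ppos Fneg; have [a a_gt0 [c c_gt0 decay]] := lyapunov_decay Ppos Fneg.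
split=> [eps eps_gt0|x xF].
  exists (eps / c); first by rewrite divr_gt0.
  move=> x xF x0 t t_ge0; apply: le_lt_trans (decay x xF t t_ge0) _.
  rewrite ltr_pdivlMr // mulrC in x0; apply: le_lt_trans x0.
  rewrite ler_wpM2r // ler_piMr ?(ltW c_gt0) // expR_le1.
  by rewrite oppr_le0 mulr_ge0 // ltW.
apply/cvgr0Pnorm_lt => eps eps_gt0.
near=> t.
have t_gt0 : 0 < t by near: t; exact: nbhs_pinfty_gt.
apply: le_lt_trans (decay x xF t (ltW t_gt0)) _.
rewrite expRN mulrAC ltr_pdivrMr ?expR_gt0 //.
(* The convexity bound [1 + a * t <= expR (a * t)] already forces decay. *)
apply: lt_le_trans (_ : eps * (1 + a * t) <= _); last first.
  by rewrite ler_pM2l // expR_ge1Dx.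
rewrite mulrDr mulr1 ltr_wpDl ?(ltW eps_gt0) // mulrA -ltr_pdivrMl ?mulr_gt0 //.
by near: t; apply: nbhs_pinfty_gt; rewrite num_real.
Unshelve. all: by end_near.
Qed.

(** If [p + i q] is an eigenvector for [al + i be] with [0 <= al], then the real
part [x] and the imaginary part [y] of [expR ((al + i be) t) (p + i q)] are real
solutions, and [x_k ^+ 2 + y_k ^+ 2] never falls below its value at time 0,
which is positive for some coordinate [k].  So [x] and [y] do not both converge
to 0. *)
Lemma stable_hurwitz (R : realType) k (F : 'M[R]_k) :
  asymptotically_stable F -> hurwitz F.
Proof.
move=> [_ attr] [al be] /=; set Fc := map_mx _ F; set lam := Complex al be.
(* [eigenvalue] is about row eigenvectors, the solution needs a column one. *)
rewrite eigenvalue_unitmx -unitmx_tr linearB /= tr_scalar_mx -eigenvalue_unitmx.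
move=> /eigenvalueP[u uFc /rV0Pn[k0 uk0]]; rewrite ltNge; apply/negP => al_ge0.
pose p := \col_i complex.Re (u 0 i); pose q := \col_i complex.Im (u 0 i).
have uF i : \sum_j (F i j)%:C%C * u 0 j = lam * u 0 i.
  have := congr1 (fun w : 'rV__ => w 0 i) uFc; rewrite !mxE => <-.
  by apply: eq_bigr => j _; rewrite !mxE mulrC.
have Fp : F *m p = al *: p - be *: q.
  apply/colP => i; have := congr1 (@complex.Re R) (uF i); rewrite Re_sum !mxE.
  case: (u 0 i) => x y /= <-; apply: eq_bigr => j _; rewrite !mxE.
  by case: (u 0 j) => ? ? /=; rewrite mul0r subr0.
have Fq : F *m q = be *: p + al *: q.
  apply/colP => i; have := congr1 (@complex.Im R) (uF i); rewrite Im_sum !mxE.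
  case: (u 0 i) => x y /=; rewrite [RHS]addrC => <-.
  apply: eq_bigr => j _; rewrite !mxE.
  by case: (u 0 j) => ? ? /=; rewrite mul0r addr0.
pose e t := expR (al * t); pose C t := cos (be * t); pose S t := sin (be * t).
pose x t := (e t * C t) *: p - (e t * S t) *: q.
pose y t := (e t * S t) *: p + (e t * C t) *: q.
have xF : solution F x.
  move=> t _; apply/is_derive_mxP => i j; rewrite ord1 /x.
  under eq_fun do rewrite !mxE /e /C /S.
  apply: is_derive_eq.
  rewrite mulmxBr -!scalemxAr Fp Fq !mxE /GRing.scale /= /e /C /S; ring.
have yF : solution F y.
  move=> t _; apply/is_derive_mxP => i j; rewrite ord1 /y.
  under eq_fun do rewrite !mxE /e /C /S.
  apply: is_derive_eq.
  rewrite mulmxDr -!scalemxAr Fp Fq !mxE /GRing.scale /= /e /C /S; ring.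
pose r := p k0 0 ^+ 2 + q k0 0 ^+ 2.
have r_gt0 : 0 < r.
  rewrite lt_neqAle addr_ge0 ?sqr_ge0 // andbT eq_sym.
  by apply: contra uk0; rewrite paddr_eq0 ?sqr_ge0 // !sqrf_eq0 !mxE eq_complex.
have xy (t : R) : 0 <= t -> r <= x t k0 0 ^+ 2 + y t k0 0 ^+ 2.
  move=> t_ge0; have -> : x t k0 0 ^+ 2 + y t k0 0 ^+ 2 = e t ^+ 2 * r.
    have := cos2Dsin2 (be * t); rewrite -/(C t) -/(S t) => CS.
    by rewrite -[RHS]mulr1 -CS /r !mxE; ring.
  rewrite ler_peMl ?(ltW r_gt0) // exprn_ege1 // -expR0 ler_expR.
  by rewrite mulr_ge0.
(* Then [eps ^+ 2 <= eps] and [2 * eps < r]. *)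
pose eps := r / (2 + r).
have r2_gt0 : 0 < 2 + r by rewrite addr_gt0.
have eps_gt0 : 0 < eps by rewrite divr_gt0.
have eps_le1 : eps <= 1 by rewrite /eps ler_pdivrMr //; lra.
have eps_ltr : eps * 2 < r by rewrite /eps mulrAC ltr_pdivrMr //; nra.
have small (z : R -> 'cV[R]_k) : solution F z ->
    \forall t \near +oo, z t k0 0 ^+ 2 <= eps.
  move=> zF; have /cvgr0Pnorm_lt /(_ eps eps_gt0) := attr z zF.
  apply: filterS => t zt; have /le_lt_trans /(_ zt) := coord_le_mx_norm (z t) k0.
  rewrite -real_normK ?num_real //; have := normr_ge0 (z t k0 0); nra.
have [t [[t_ge0 xt] yt]] := filter_ex (filterI (filterI
  (nbhs_pinfty_ge (num_real (0 : R))) (small x xF)) (small y yF)).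
have := xy t t_ge0; lra.
Qed.

(** * Block triangular closed loops *)

(** The order of the blocks is given by a height and not by their indices:
sorting the blocks would permute the dimensions in the types. *)
Definition block_triangular (K : nmodType) N (h n : 'I_N -> nat)
    (F : forall i j, 'M[K]_(n i, n j)) : Prop :=
  forall i j, i != j -> ~~ (h j < h i)%N -> F i j = 0.

Lemma closed_loop_block (R : realType) N (n m : 'I_N -> nat)
    (A : forall i j, 'M[R]_(n i, n j)) (B : forall i, 'M[R]_(n i, m i))
    (K : forall i, 'M[R]_(m i, n i)) i j :
  submxblock (closed_loop A B K) i j =
  A i j - (if i == j then B i *m conform_mx 0 (K i) else 0).
Proof.
rewrite /closed_loop /blockdiag mul_mxblock -mxblockB mxblockK; congr (_ - _).
rewrite (bigD1 i) //= eqxx conform_mx_id big1 ?addr0 => [|l li].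
  by case: ifP => // _; rewrite mulmx0.
by rewrite eq_sym (negbTE li) mul0mx.
Qed.

Lemma closed_loop_diag (R : realType) N (n m : 'I_N -> nat)
    (A : forall i j, 'M[R]_(n i, n j)) (B : forall i, 'M[R]_(n i, m i))
    (K : forall i, 'M[R]_(m i, n i)) i :
  submxblock (closed_loop A B K) i i = A i i - B i *m K i.
Proof. by rewrite closed_loop_block eqxx conform_mx_id. Qed.

Lemma closed_loop_triangular (R : realType) N (n m : 'I_N -> nat)
    (A : forall i j, 'M[R]_(n i, n j)) (B : forall i, 'M[R]_(n i, m i))
    (K : forall i, 'M[R]_(m i, n i)) h :
  block_triangular h A -> block_triangular h (submxblock (closed_loop A B K)).
Proof.
by move=> Atri i j ij hji; rewrite closed_loop_block (negbTE ij) Atri // subr0.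
Qed.

Lemma bilin_mxdiag (R : realType) N (n : 'I_N -> nat)
    (P : forall i, 'M[R]_(n i)) u v :
  bilin (\mxdiag_i P i) (\mxcol_i u i) (\mxcol_i v i) =
  \sum_i bilin (P i) (u i) (v i).
Proof.
by rewrite /bilin tr_mxcol mul_mxrow_mxdiag mul_mxrow_mxcol summxE.
Qed.

Lemma posdef_mxdiag (R : realType) N (n : 'I_N -> nat)
    (P : forall i, 'M[R]_(n i)) :
  (forall i, posdef (P i)) -> posdef (\mxdiag_i P i).
Proof.
move=> Ppos; split.
  by rewrite tr_mxdiag; apply: eq_mxdiag => i; exact: (Ppos i).1.
move=> v v_neq0; rewrite -/(bilin _ v v) -[v]submxcolK bilin_mxdiag.
have [i vi] : exists i, submxcol v i != 0.
  apply/existsP; apply: contraNT v_neq0; rewrite negb_exists => /forallP v0.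
  rewrite -[v]submxcolK; apply/eqP/mxcolP => i; rewrite mxcolK submxcol0.
  exact/eqP/negPn.
rewrite (bigD1 i) //= ltr_wpDr //; last exact: (Ppos i).2.
by apply: sumr_ge0 => j _; exact: posdef_ge0.
Qed.

Lemma posdefZ (R : realType) k (P : 'M[R]_k) c :
  0 < c -> posdef P -> posdef (c *: P).
Proof.
move=> c_gt0 [PT Ppos]; split=> [|v /Ppos]; first by rewrite linearZ /= PT.
by move=> v_gt0; rewrite -scalemxAr -scalemxAl mxE mulr_gt0.
Qed.

(** Scaled Lyapunov matrices [c i *: Q i] of the diagonal blocks work: the
energies [bilin (Q i) (x i) (x i)] of the components of a vector form a cascade,
whose couplings [bilin (Q i) (x i) (F i j *m x j)] are controlled by
[bilin_young] once the energy of [F i j *m x j] in block [i] is bounded by that of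
[x j] in block [j]. *)
Lemma block_lyapunov (R : realType) N (h n : 'I_N -> nat)
    (F : forall i j, 'M[R]_(n i, n j)) :
  block_triangular h F ->
  (forall i, exists2 P : 'M[R]_(n i), posdef P &
     negdef ((F i i)^T *m P + P *m F i i)) ->
  exists2 P : forall i, 'M[R]_(n i), forall i, posdef (P i) &
    negdef ((\mxblock_(i, j) F i j)^T *m \mxdiag_i P i
            + \mxdiag_i P i *m \mxblock_(i, j) F i j).
Proof.
move=> Ftri Fneg.
pose Q i := s2val (cid2 (Fneg i)).
have Qpos i : posdef (Q i) := s2valP (cid2 (Fneg i)).
have Qneg i : negdef ((F i i)^T *m Q i + Q i *m F i i) :=
  s2valP' (cid2 (Fneg i)).
pose rate i := cid2 (lyapunov_rate (Qpos i) (Qneg i)).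
have [a a_gt0 aP] := pos_lower_bound (fun i => s2valP (rate i)).
pose dom i j := cid2 (posdef_dominates ((F i j)^T *m Q i *m F i j) (Qpos j)).
have [b b_gt0 bP] : exists2 b, 0 < b & forall i j, s2val (dom i j) <= b.
  have dom_ge0 i j : 0 <= s2val (dom i j) by apply/ltW/(s2valP (dom i j)).
  exists (1 + \sum_i \sum_j s2val (dom i j)).
    by rewrite ltr_wpDr // sumr_ge0 // => i _; apply: sumr_ge0.
  move=> i j; rewrite (bigD1 i) //= (bigD1 j) //= addrCA -addrA lerDl.
  rewrite !addr_ge0 //; first by apply: sumr_ge0.
  by apply: sumr_ge0 => l _; apply: sumr_ge0.
have [c c_gt0 cP] := dissipative_weights h a_gt0 b_gt0.
exists (fun i => c i *: Q i) => [i|]; first exact: posdefZ.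
apply/negdef_lyapunov => [|v v_neq0].
  rewrite tr_mxdiag; apply: eq_mxdiag => i.
  by rewrite linearZ /= (Qpos i).1.
pose x i := submxcol v i; have vE : v = \mxcol_i x i by rewrite submxcolK.
pose X i j := bilin (Q i) (x i) (F i j *m x j).
have bZ i u w : bilin (c i *: Q i) u w = c i * bilin (Q i) u w.
  by rewrite /bilin -scalemxAr -scalemxAl mxE.
have bS i u (g : 'I_N -> 'cV_(n i)) :
    bilin (Q i) u (\sum_j g j) = \sum_j bilin (Q i) u (g j).
  by rewrite /bilin mulmx_sumr summxE.
rewrite vE mul_mxblock_mxrow bilin_mxdiag.
under eq_bigr do rewrite bZ bS -/(X _ _).
apply: le_lt_trans (cP (fun i => bilin (Q i) (x i) (x i)) X _ _ _ _) _ => /=.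
- by move=> i; exact: posdef_ge0.
- move=> i; apply: le_trans (s2valP' (rate i) _) _.
  by apply: ler_wpM2r; [exact: posdef_ge0 | rewrite lerN2].
- by move=> i j ij hji; rewrite /X Ftri // mul0mx /bilin mulmx0 mxE.
- move=> i j s s_gt0.
  have := bilin_young (x i) (F i j *m x j) (Qpos i) s_gt0; rewrite -/(X i j).
  have : bilin (Q i) (F i j *m x j) (F i j *m x j) / s <=
      b * bilin (Q j) (x j) (x j) / s.
    rewrite ler_wpM2r ?invr_ge0 ?(ltW s_gt0) //.
    apply: le_trans (ler_wpM2r (posdef_ge0 _ (Qpos j)) (bP i j)).
    apply: le_trans (s2valP' (dom i j) _).
    by rewrite /bilin trmx_mul !mulmxA.
  have : 0 <= s * bilin (Q i) (x i) (x i).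
    by rewrite mulr_ge0 ?posdef_ge0 ?(ltW s_gt0).
  have : 0 <= b * bilin (Q j) (x j) (x j) / s.
    by rewrite !mulr_ge0 ?posdef_ge0 ?invr_ge0 ?(ltW s_gt0) ?(ltW b_gt0).
  lra.
rewrite mulNr oppr_lt0 mulr_gt0 // ?divr_gt0 //.
have [_ /(_ v v_neq0)] := posdef_mxdiag (fun i => posdefZ (c_gt0 i) (Qpos i)).
rewrite -/(bilin _ v v) vE bilin_mxdiag => /lt_le_trans -> //.
by apply: ler_sum => i _; rewrite bZ.
Qed.

Lemma submxcolZ (K : pzRingType) N (p : 'I_N -> nat) l (a : K)
    (M : 'M[K]_(\sum_i p i, l)) i : submxcol (a *: M) i = a *: submxcol M i.
Proof. by apply/matrixP => j k; rewrite !mxE. Qed.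

(** Suppose [F - a] is invertible, while some diagonal block has [a] as an
eigenvalue, and choose such a block [k] of least height.  Let [y] be supported
in block [k] and solve [(F - a) x = y].  The components of [x] of smaller height
vanish, one height after the other, since the corresponding diagonal blocks of
[F - a] are invertible.  So [(F k k - a) x_k = y_k], for arbitrary [y_k]: hence
[F k k - a] is surjective.  But a left eigenvector [u] of [F k k] for [a]
annihilates the image of [F k k - a], so that [u] is zero. *)
Lemma block_eigenvalue (K : fieldType) N (h n : 'I_N -> nat)
    (F : forall i j, 'M[K]_(n i, n j)) i a :
  block_triangular h F -> eigenvalue (F i i) a ->
  eigenvalue (\mxblock_(i, j) F i j) a.
Proof.
move=> Ftri Fi.
have [k Fk kmin] := @arg_minnP _ i (fun j => eigenvalue (F j j) a) h Fi.
rewrite eigenvalue_unitmx; apply/negP => Munit.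
have /eigenvalueP[u uF /negP u_neq0] := Fk; apply/u_neq0/eqP/matrixP => z l.
set G := _ - _ in Munit.
(* Under the test [i == k] the dimensions agree and [conform_mx] is the
   identity. *)
pose y : 'cV[K]_(\sum_i n i) := \mxcol_i
   (if i == k then conform_mx 0 (delta_mx l 0 : 'cV_(n k)) else 0).
pose x i := submxcol (invmx G *m y) i.
have Gx j : \sum_l F j l *m x l - a *: x j =
    (if j == k then conform_mx 0 (delta_mx l 0 : 'cV_(n k)) else 0).
  have : G *m \mxcol_i x i = y by rewrite submxcolK mulKVmx.
  rewrite mulmxBl mul_mxblock_mxrow mul_scalar_mx submxcolK.
  move=> /(congr1 (fun z => submxcol z j)).
  by rewrite submxcolB !mxcolK submxcolZ.
have x0 p j : (h j < p)%N -> (p <= h k)%N -> x j = 0.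
  elim: p j => // p IH j; rewrite ltnS => hjp pk.
  have jk : j != k.
    by apply: contraTneq (leq_ltn_trans hjp pk) => ->; rewrite ltnn.
  have Fx0 : (F j j - a%:M) *m x j = 0.
    have := Gx j; rewrite (negbTE jk) (bigD1 j) //= big1 => [|l' l'j].
      by rewrite addr0 mulmxBl mul_scalar_mx.
    have [l'lt|/Ftri->] := boolP (h l' < h j)%N; last by rewrite eq_sym.
      by rewrite (IH l') ?mulmx0 ?(leq_trans l'lt) // ltnW.
    by rewrite mul0mx.
  have Funit : F j j - a%:M \in unitmx.
    rewrite -[_ \in _]negbK -eigenvalue_unitmx; apply/negP => /kmin.
    by rewrite leqNgt (leq_ltn_trans hjp).
  by rewrite -(mulKmx Funit (x j)) Fx0 mulmx0.
have : (F k k - a%:M) *m x k = delta_mx l 0.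
  have := Gx k; rewrite eqxx conform_mx_id (bigD1 k) //= big1 => [|j jk].
    by rewrite addr0 mulmxBl mul_scalar_mx.
  have [jlt|/Ftri->] := boolP (h j < h k)%N; last by rewrite eq_sym.
    by rewrite (x0 _ _ jlt) // mulmx0.
  by rewrite mul0mx.
move=> /(congr1 (mulmx u)); rewrite mulmxA mulmxBr uF mul_mx_scalar subrr mul0mx.
by rewrite -colE => /matrixP /(_ z 0); rewrite !mxE.
Qed.

(** The number of nodes from which [x] can be reached grows strictly along an
edge from [x] to [y], since [y] itself is new: if [y] reached [x], a path
without repeated nodes from [y] to [x] would close up to a cycle with the
edge. *)
Lemma acyclic_height (V : finType) (E : rel V) : acyclic_graph E ->
  exists h : V -> nat, forall x y, E x y -> (h x < h y)%N.
Proof.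
move=> acyc; exists (fun x => #|[set z | connect E z x]|) => x y Exy.
apply/proper_card/properP; split.
  apply/fintype.subsetP => z; rewrite !inE => zx.
  exact: connect_trans zx (connect1 Exy).
exists y; rewrite inE ?connect0 //; apply/negP => /connectP[s0 ys0 xE].
move: ys0 xE => /shortenP[s ys us _] xE.
suff : ucycle E (y :: s) by move/acyc.
by rewrite /ucycle us andbT /cycle rcons_path ys -xE.
Qed.

Theorem proposition2 (R : realType) (N : nat) (n m : 'I_N -> nat)
  (Ep : rel 'I_N)
  (A : forall i j, 'M[R]_(n i, n j)) (B : forall i, 'M[R]_(n i, m i))
  (Ep_irr : irreflexive Ep)
  (A_Ep : forall i j : 'I_N, i != j -> ~~ Ep j i -> A i j = 0)
  (Ep_acyclic : acyclic_graph Ep) :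
  (decentralized_stabilizable A B <-> strongly_decentralized_stabilizable A B) /\
  (strongly_decentralized_stabilizable A B <->
     forall i : 'I_N, stabilizable (A i i) (B i)).
Proof.
have [h hE] := acyclic_height Ep_acyclic.
have Atri : block_triangular h A.
  by move=> i j ij hji; apply: A_Ep => //; apply: contra hji; exact: hE.
have strong_dec : strongly_decentralized_stabilizable A B ->
    decentralized_stabilizable A B.
  move=> [K [P [Ppos KP]]]; exists K; apply: lyapunov_stable KP.
  exact: posdef_mxdiag.
have dec_local : decentralized_stabilizable A B ->
    forall i, stabilizable (A i i) (B i).
  move=> [K /stable_hurwitz Khur] i; exists (K i) => lam lamP; apply: Khur.
  have -> : map_mx (real_complex R) (closed_loop A B K) =
      \mxblock_(j, l) map_mx (real_complex R)
        (submxblock (closed_loop A B K) j l).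
    apply/mxblockP => j l; rewrite mxblockK.
    by apply/matrixP => s t; rewrite !mxE.
  apply: (@block_eigenvalue _ _ h _ _ i).
    by move=> j l jl hlj; rewrite (closed_loop_triangular B K Atri) // map_mx0.
  by rewrite closed_loop_diag.
have local_strong : (forall i, stabilizable (A i i) (B i)) ->
    strongly_decentralized_stabilizable A B.
  move=> stab; pose K i := sval (cid (stab i)); exists K.
  have [|P Ppos PK] := block_lyapunov (closed_loop_triangular B K Atri).
    move=> i; rewrite closed_loop_diag; apply: hurwitz_lyapunov.
    exact: svalP (cid (stab i)).
  by exists P; rewrite -[closed_loop A B K]submxblockK.
split; split=> // ?; first exact/local_strong/dec_local.
exact/dec_local/strong_dec.
Qed.
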